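(* Let $F$ be a topological field and let $\Lambda$ be an infinite, locally finite preordered set. Let $Z_\Lambda(F)$ denote the center of the group $\mathrm{aGL}_\Lambda(F)$. Then $Z_\Lambda(F)$ is the unique largest proper closed normal subgroup of $\mathrm{aGL}_\Lambda(F)$ (that is, $Z_\Lambda(F)$ is a proper closed normal subgroup, and it contains every proper closed normal subgroup of $\mathrm{aGL}_\Lambda(F)$). In particular, the quotient $\mathrm{aPGL}_\Lambda(F):=\mathrm{aGL}_\Lambda(F)/Z_\Lambda(F)$, with the quotient topology, is topologically simple (its only closed normal subgroups are the trivial subgroup and the whole group).
   Context: A preordered set (proset) $(\Lambda,\preceq)$ is locally finite if for all $s_1\preceq s_2$ the interval $[s_1,s_2]=\{s\in\Lambda: s_1\preceq s\preceq s_2\}$ is finite. Topological fields are Hausdorff, with continuous inversion on nonzero elements. For a locally finite proset $\Lambda$ and a commutative ring $P$ (with identity, nontrivial), the incidence ring is $\mathrm{M}_\Lambda(P)=\{(a_{s_1,s_2})\in P^{\Lambda\times\Lambda}: a_{s_1,s_2}\neq 0\Rightarrow s_1\preceq s_2\}$ with coordinatewise addition and multiplication $(ab)_{s_1,s_2}=\sum_{t\in[s_1,s_2]}a_{s_1,t}b_{t,s_2}$ (for $s_1\preceq s_2$; other entries are $0$). Its group of units is denoted $\mathrm{GL}_\Lambda(P)$. If $P$ is a topological ring, $\mathrm{M}_\Lambda(P)$ and $\mathrm{GL}_\Lambda(P)$ carry the subspace topology from the product topology on $P^{\Lambda\times\Lambda}$. For a finite subset $S\subset\Lambda$, $\Lambda+S$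 denotes the set $\Lambda$ with the smallest preorder $\preceq_+$ containing $\preceq$ for which all elements of $S$ are equivalent (i.e. $s\preceq_+ t$ and $t\preceq_+ s$ for all $s,t\in S$); it is again locally finite when $\Lambda$ is. For $S_1\subset S_2$ one has $\mathrm{GL}_{\Lambda+S_1}(P)\subset \mathrm{GL}_{\Lambda+S_2}(P)$ as subsets of $P^{\Lambda\times\Lambda}$, and this inclusion is a group homomorphism. The almost general linear group is $\mathrm{aGL}_\Lambda(P)=\bigcup_{S\subset\Lambda\text{ finite}}\mathrm{GL}_{\Lambda+S}(P)$ with the induced group operation. When $P=F$ is a topological field, $\mathrm{aGL}_\Lambda(F)$ has the final topology with respect to the inclusions $\mathrm{GL}_{\Lambda+S}(F)\hookrightarrow\mathrm{aGL}_\Lambda(F)$, $S\subset\Lambda$ finite (a subset is closed iff its intersection with each $\mathrm{GL}_{\Lambda+S}(F)$ is closed there). *)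

(* Defs.v *)
From HB Require Import structures.
From mathcomp Require Import all_boot all_order all_algebra.
From mathcomp Require Import all_classical.
From mathcomp Require Import finmap topology tvs.

Set Implicit Arguments.
Unset Strict Implicit.
Unset Printing Implicit Defensive.

Import Order.Theory GRing.Theory.

Local Open Scope classical_set_scope.
Local Open Scope ring_scope.

HB.mixin Record TopologicalZmodule_isTopologicalField F
    & TopologicalZmodule F & GRing.Field F := {
  mul_continuous : continuous (fun x : F * F => x.1 * x.2) ;
  inv_continuous : forall x : F, x != 0 -> {for x, continuous (@GRing.inv F)} ;
  field_hausdorff : hausdorff_space F
}.

#[short(type="topologicalFieldType")]
HB.structure Definition TopologicalField :=
  {F of TopologicalZmodule F & GRing.Field F
      & TopologicalZmodule_isTopologicalField F}.

HB.mixin Record Preorder_isLocallyFinite (d : Order.disp_t) T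
    & Order.Preorder d T := {
  finite_itvcc : forall s1 s2 : T, (s1 <= s2)%O ->
    finite_set [set s : T | (s1 <= s <= s2)%O]
}.

#[short(type="lfPreorderType")]
HB.structure Definition LocallyFinitePreorder (d : Order.disp_t) :=
  {T of Order.Preorder d T & Preorder_isLocallyFinite d T}.

Section LocallyFiniteTheory.
Context {d : Order.disp_t} {L : lfPreorderType d}.

Lemma finite_itv (s1 s2 : L) : finite_set [set s : L | (s1 <= s <= s2)%O].
Proof.
have [/finite_itvcc //|s12] := boolP (s1 <= s2)%O.
apply: (sub_finite_set _ (finite_set0 L)) => s /= /andP[h1 h2].
by rewrite (le_trans h1 h2) in s12.
Qed.

End LocallyFiniteTheory.

Definition is_preorder (T : Type) (R : set (T * T)) : Prop :=
  (forall s, R (s, s)) /\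
  (forall s t u, R (s, t) -> R (t, u) -> R (s, u)).

Definition plus_rel (d : Order.disp_t) (L : preorderType d) (S : {fset L}) :
    set (L * L) :=
  smallest (@is_preorder L)
    ([set st | (st.1 <= st.2)%O] `|` [set` S] `*` [set` S]).

(* The carrier of L, with plus_rel S as preorder. As the carrier is unchanged,
   matrices over L + S are matrices over L by conversion. *)
Definition preorder_plus (d : Order.disp_t) (L : preorderType d) (S : {fset L}) :
  Type := L.

Section PlusTheory.
Context {d : Order.disp_t} {L : preorderType d}.
Implicit Types S : {fset L}.

Lemma plus_rel_refl S (s : L) : plus_rel S (s, s).
Proof. by move=> R [[rR _] _]; exact: rR. Qed.

Lemma plus_rel_trans S (t s u : L) :
  plus_rel S (s, t) -> plus_rel S (t, u) -> plus_rel S (s, u).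
Proof.
move=> st tu R RP; have [[_ tR] _] := RP.
apply: (tR _ t); [exact: st | exact: tu].
Qed.

Lemma plus_rel_le S (s t : L) : (s <= t)%O -> plus_rel S (s, t).
Proof. by move=> st R [_ sR]; apply: sR; left. Qed.

Lemma plus_rel_mem S (s t : L) : s \in S -> t \in S -> plus_rel S (s, t).
Proof. by move=> sS tS R [_ sR]; apply: sR; right; split. Qed.

Lemma plus_relP S (s t : L) : plus_rel S (s, t) <->
  (s <= t)%O \/ exists a b, [/\ a \in S, b \in S, (s <= a)%O & (b <= t)%O].
Proof.
split=> [|[st|[a [b [aS bS sa bt]]]]].
- move=> /(_ [set st | (st.1 <= st.2)%O \/ exists a b,
    [/\ a \in S, b \in S, (st.1 <= a)%O & (b <= st.2)%O]]) /=; apply.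
  split; first split=> [x /=|x y z /=]; first by left.
    case=> [xy|[a [b [aS bS xa yb]]]] [yz|[a' [b' [aS' bS' xa' yb']]]].
    + by left; exact: le_trans yz.
    + by right; exists a', b'; split=> //; exact: le_trans xa'.
    + by right; exists a, b; split=> //; exact: le_trans yz.
    + by right; exists a, b'.
  case=> x y /= [xy|[/= xS yS]]; first by left.
  by right; exists x, y.
- exact: plus_rel_le.
- exact: (plus_rel_trans (plus_rel_le sa)
    (plus_rel_trans (plus_rel_mem aS bS) (plus_rel_le bt))).
Qed.

Lemma plus_rel_sub S1 S2 : {subset S1 <= S2} -> plus_rel S1 `<=` plus_rel S2.
Proof.
move=> S12 [s t] /plus_relP H; apply/plus_relP.
case: H => [|[a [b [aS bS sa bt]]]]; [by left|right].
by exists a, b; split=> //; exact: S12.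
Qed.

HB.instance Definition _ S := Choice.on (preorder_plus S).

Let plus_le S : rel (preorder_plus S) := fun s t => `[< plus_rel S (s, t) >].

Let plus_le_refl S : reflexive (@plus_le S).
Proof. by move=> s; apply/asboolP; exact: plus_rel_refl. Qed.

Let plus_le_trans S : transitive (@plus_le S).
Proof.
by move=> t s u /asboolP st /asboolP tu; apply/asboolP; exact: (plus_rel_trans st tu).
Qed.

HB.instance Definition _ S := Order.Le_isPreorder.Build d (preorder_plus S)
  (@plus_le_refl S) (@plus_le_trans S).

Lemma le_plusE S (s t : preorder_plus S) :
  (s <= t)%O = `[< plus_rel S (s, t) >].
Proof. by []. Qed.

End PlusTheory.

Section PlusLocallyFinite.
Context {d : Order.disp_t} {L : lfPreorderType d}.

Lemma plus_finite_itvcc (S : {fset L}) (s1 s2 : preorder_plus S) :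
  (s1 <= s2)%O -> finite_set [set s : preorder_plus S | (s1 <= s <= s2)%O].
Proof.
move=> _; pose A (x : L) : set L := [set y | y = x \/ y \in S].
have finA x : finite_set (A x).
  apply: (@sub_finite_set _ _ ([set x] `|` [set` S])) => //.
  by rewrite finite_setU; split.
apply: (@sub_finite_set L _
  (\bigcup_(c in A s1) \bigcup_(e in A s2) [set s : L | (c <= s <= e)%O])).
  move=> s /= /andP[/asboolP/plus_relP h1 /asboolP/plus_relP h2].
  have [c Ac cs] : exists2 c, A s1 c & (c <= s)%O.
    case: h1 => [?|[a [b [aS bS _ bs]]]]; first by exists s1 => //; left.
    by exists b => //; right.
  have [e Ae se] : exists2 e, A s2 e & (s <= e)%O.
    case: h2 => [?|[a [b [aS bS sa _]]]]; first by exists s2 => //; left.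
    by exists a => //; right.
  by exists c => //; exists e => //=; rewrite cs.
apply: bigcup_finite => // c _; apply: bigcup_finite => // e _.
exact: finite_itv.
Qed.

HB.instance Definition _ (S : {fset L}) :=
  Preorder_isLocallyFinite.Build d (preorder_plus S) (@plus_finite_itvcc S).

End PlusLocallyFinite.

Definition incidence_ring (d : Order.disp_t) (L : lfPreorderType d)
    (P : comNzRingType) : set (L * L -> P) :=
  [set a | forall s1 s2, a (s1, s2) != 0 -> (s1 <= s2)%O].
Arguments incidence_ring {d} L P.

(* The interval, hence the sum, is empty unless s.1 <= s.2. *)
Definition incidence_mul (d : Order.disp_t) (L : lfPreorderType d)
    (P : comNzRingType) (a b : L * L -> P) : L * L -> P :=
  fun s => \sum_(t \in [set t : L | (s.1 <= t <= s.2)%O]) a (s.1, t) * b (t, s.2).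
Arguments incidence_mul {d} L P.

Definition incidence_one (L : eqType) (P : comNzRingType) : L * L -> P :=
  fun s => (s.1 == s.2)%:R.
Arguments incidence_one : clear implicits.

Definition GL (d : Order.disp_t) (L : lfPreorderType d) (P : comNzRingType) :
    set (L * L -> P) :=
  [set a | incidence_ring L P a /\
     exists2 b, incidence_ring L P b &
       incidence_mul L P a b = incidence_one L P /\
       incidence_mul L P b a = incidence_one L P].
Arguments GL {d} L P.

Definition aGL_set (d : Order.disp_t) (L : lfPreorderType d)
    (P : comNzRingType) : set (L * L -> P) :=
  \bigcup_(S in [set: {fset L}]) (GL (preorder_plus S) P : set (L * L -> P)).
Arguments aGL_set {d} L P.

(* Finitely supported sum over all indices: a formula for the product that does
   not mention the preorder, so that it is common to all L + S
   (see incidence_mulE). *)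
Definition matrix_mul (L : choiceType) (P : comNzRingType) (a b : L * L -> P) :
    L * L -> P :=
  fun s => \sum_(t \in [set: L]) a (s.1, t) * b (t, s.2).
Arguments matrix_mul : clear implicits.

Section IncidenceTheory.
Context {d : Order.disp_t} {L : lfPreorderType d} {P : comNzRingType}.
Implicit Types a b c : L * L -> P.
Local Notation M := (incidence_ring L P).
Local Notation "a ** b" := (incidence_mul L P a b) (at level 40).
Local Notation one := (incidence_one L P).

Lemma incidence_eq0 a s t : M a -> ~~ (s <= t)%O -> a (s, t) = 0.
Proof. by move=> Ma; apply: contraNeq => /Ma. Qed.

Lemma incidence_mulE a b : M a -> M b -> a ** b = matrix_mul L P a b.
Proof.
move=> Ma Mb; apply/funext => -[s u]; apply: fsbig_widen => //= t [_ /negP].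
rewrite /= negb_and => /orP[h|h]; first by rewrite (incidence_eq0 Ma h) mul0r.
by rewrite (incidence_eq0 Mb h) mulr0.
Qed.

Lemma incidence_mulM a b : M a -> M b -> M (a ** b).
Proof.
move=> Ma Mb s u; apply: contraNT => su.
rewrite /incidence_mul/= (_ : [set t | _] = set0) ?fsbig_set0//.
by apply/seteqP; split=> t //= /andP[st tu]; rewrite (le_trans st tu) in su.
Qed.

Lemma incidence_one_in : M one.
Proof.
by move=> s t; rewrite /incidence_one/=; have [->|] := eqVneq s t; rewrite ?lexx ?eqxx.
Qed.

Lemma incidence_mul1r a : M a -> one ** a = a.
Proof.
move=> Ma; apply/funext => -[s u]; rewrite incidence_mulE//; last exact: incidence_one_in.
rewrite /matrix_mul /= -(fsbig_widen [set s])//= ?fsbig_set1/=; last first.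
  by move=> t [_ /= /eqP]; rewrite /incidence_one/= eq_sym => /negPf ->; rewrite mul0r.
by rewrite /incidence_one/= eqxx mul1r.
Qed.

Lemma incidence_mulr1 a : M a -> a ** one = a.
Proof.
move=> Ma; apply/funext => -[s u]; rewrite incidence_mulE//; last exact: incidence_one_in.
rewrite /matrix_mul /= -(fsbig_widen [set u])//= ?fsbig_set1/=; last first.
  by move=> t [_ /= /eqP]; rewrite /incidence_one/= => /negPf ->; rewrite mulr0.
by rewrite /incidence_one/= eqxx mulr1.
Qed.

Lemma incidence_mulA a b c : M a -> M b -> M c -> a ** (b ** c) = (a ** b) ** c.
Proof.
move=> Ma Mb Mc; apply/funext => -[s u]; rewrite /incidence_mul/=.
set A := [set t | (s <= t <= u)%O]; have finA : finite_set A by exact: finite_itv.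
transitivity (\sum_(t \in A) \sum_(v \in A) (a (s, t) * b (t, v) * c (v, u))).
  apply: eq_fsbigr => t /set_mem /andP[st tu].
  rewrite (fsbig_widen _ A)/=; last 2 first.
  - by move=> v /= /andP[tv vu]; rewrite /A/= vu (le_trans st tv).
  - move=> v [/= /andP[sv vu]]; rewrite vu andbT => /negP tv.
    by rewrite (incidence_eq0 Mb tv) mul0r.
  rewrite !fsbig_finite// mulr_sumr; apply: eq_bigr => v _.
  by rewrite mulrA.
rewrite exchange_fsbig//; apply: eq_fsbigr => v /set_mem /andP[sv vu].
rewrite [in RHS](fsbig_widen _ A)/=; last 2 first.
- by move=> t /= /andP[st tv]; rewrite /A/= st (le_trans tv vu).
- move=> t [/= /andP[st tu]]; rewrite st/= => /negP tv.
  by rewrite (incidence_eq0 Mb tv) mulr0.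
by rewrite !fsbig_finite// mulr_suml.
Qed.

Lemma GL1 : GL L P one.
Proof.
have M1 := incidence_one_in; split=> //; exists one => //.
by split; rewrite incidence_mul1r.
Qed.

Lemma GL_mul a b : GL L P a -> GL L P b -> GL L P (a ** b).
Proof.
move=> [Ma [a' Ma' [aa' a'a]]] [Mb [b' Mb' [bb' b'b]]].
split; first exact: incidence_mulM.
exists (b' ** a'); first exact: incidence_mulM.
split.
  rewrite -incidence_mulA//; last exact: incidence_mulM.
  by rewrite (incidence_mulA Mb)// bb' incidence_mul1r.
rewrite -incidence_mulA//; last exact: incidence_mulM.
by rewrite (incidence_mulA Ma')// a'a incidence_mul1r.
Qed.

End IncidenceTheory.

Section aGLTheory.
Context {d : Order.disp_t} {L : lfPreorderType d} {P : comNzRingType}.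
Implicit Types (S : {fset L}) (a b c : L * L -> P).
Local Notation M S := (incidence_ring (preorder_plus S) P).
Local Notation G S := (GL (preorder_plus S) P).
Local Notation "a ** b" := (matrix_mul L P a b) (at level 40).
Local Notation one := (incidence_one L P).

Lemma incidence_ring_plus_sub S1 S2 : {subset S1 <= S2} -> M S1 `<=` M S2.
Proof.
by move=> S12 a Ma s t /Ma /asboolP st; apply/asboolP; exact: (plus_rel_sub S12 st).
Qed.

Lemma plus_mulE S a b : M S a -> M S b ->
  incidence_mul (preorder_plus S) P a b = a ** b.
Proof. exact: incidence_mulE. Qed.

Lemma GL_plus_sub S1 S2 : {subset S1 <= S2} -> G S1 `<=` G S2.
Proof.
move=> S12 a [Ma [b Mb [ab ba]]].
have Ma2 := incidence_ring_plus_sub S12 Ma.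
have Mb2 := incidence_ring_plus_sub S12 Mb.
split=> //; exists b => //; split.
  by rewrite plus_mulE// -(plus_mulE Ma Mb).
by rewrite plus_mulE// -(plus_mulE Mb Ma).
Qed.

Lemma aGL_mulE S a b : G S a -> G S b ->
  a ** b = incidence_mul (preorder_plus S) P a b.
Proof. by move=> [Ma _] [Mb _]; rewrite plus_mulE. Qed.

Lemma aGL_common2 a b : aGL_set L P a -> aGL_set L P b ->
  exists S, G S a /\ G S b.
Proof.
move=> [S1 _ aS1] [S2 _ bS2]; exists (S1 `|` S2)%fset; split.
  by apply: GL_plus_sub aS1 => x; rewrite in_fsetU => ->.
by apply: GL_plus_sub bS2 => x; rewrite in_fsetU => ->; rewrite orbT.
Qed.

Lemma aGL_set1 : aGL_set L P one.
Proof. by exists fset0 => //; exact: (@GL1 _ (preorder_plus fset0)). Qed.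

Lemma aGL_set_mul a b : aGL_set L P a -> aGL_set L P b -> aGL_set L P (a ** b).
Proof.
move=> /aGL_common2 /[apply] -[S [aS bS]]; exists S => //.
by rewrite (aGL_mulE aS bS); exact: GL_mul.
Qed.

Lemma aGL_set_mulA a b c : aGL_set L P a -> aGL_set L P b -> aGL_set L P c ->
  a ** (b ** c) = (a ** b) ** c.
Proof.
move=> [S1 _ a1] [S2 _ b2] [S3 _ c3]; pose S := (S1 `|` S2 `|` S3)%fset.
have aS : G S a by apply: GL_plus_sub a1 => x; rewrite !in_fsetU => ->.
have bS : G S b by apply: GL_plus_sub b2 => x; rewrite !in_fsetU => ->; rewrite orbT.
have cS : G S c by apply: GL_plus_sub c3 => x; rewrite !in_fsetU => ->; rewrite orbT.
have [[[Ma _] [Mb _]] [Mc _]] := (aS, bS, cS).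
rewrite (aGL_mulE bS cS) (aGL_mulE aS bS).
rewrite -(plus_mulE Ma); last exact: incidence_mulM.
rewrite -(@plus_mulE S _ c)//; last exact: incidence_mulM.
exact: (incidence_mulA Ma Mb Mc).
Qed.

Lemma aGL_set_mul1 a : aGL_set L P a -> one ** a = a.
Proof.
move=> [S _ [Ma _]]; rewrite -(@plus_mulE S)//; last exact: (@incidence_one_in _ (preorder_plus S)).
exact: (incidence_mul1r Ma).
Qed.

Lemma aGL_setr1 a : aGL_set L P a -> a ** one = a.
Proof.
move=> [S _ [Ma _]]; rewrite -(@plus_mulE S)//; last exact: (@incidence_one_in _ (preorder_plus S)).
exact: (incidence_mulr1 Ma).
Qed.

Lemma aGL_set_inv a : aGL_set L P a ->
  exists b, [/\ aGL_set L P b, a ** b = one & b ** a = one].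
Proof.
move=> [S _ [Ma [b Mb [ab ba]]]]; exists b; split.
- by exists S => //; split=> //; exists a.
- by rewrite -(plus_mulE Ma Mb).
- by rewrite -(plus_mulE Mb Ma).
Qed.

End aGLTheory.

Definition aGL (d : Order.disp_t) (L : lfPreorderType d) (P : comNzRingType) :
  Type := set_type (aGL_set L P).
Arguments aGL {d} L P.

Section aGLGroup.
Context {d : Order.disp_t} {L : lfPreorderType d} {P : comNzRingType}.
Implicit Types x y : aGL L P.

HB.instance Definition _ := Choice.on (aGL L P).

Definition aGL_of (a : L * L -> P) (ha : aGL_set L P a) : aGL L P :=
  exist _ a (mem_set ha).

Definition aGL_val x : L * L -> P := set_val x.

Lemma aGL_valP x : aGL_set L P (aGL_val x).
Proof. exact: set_valP. Qed.

Lemma aGL_val_inj : injective aGL_val.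
Proof. exact: val_inj. Qed.

Definition aGL_one : aGL L P := aGL_of aGL_set1.

Definition aGL_mul x y : aGL L P :=
  aGL_of (aGL_set_mul (aGL_valP x) (aGL_valP y)).

Definition aGL_inv x : aGL L P :=
  let e := cid (aGL_set_inv (aGL_valP x)) in
  aGL_of (let: And3 h _ _ := projT2 e in h).

Lemma aGL_mulA : associative aGL_mul.
Proof.
move=> x y z; apply: aGL_val_inj.
exact: aGL_set_mulA (aGL_valP x) (aGL_valP y) (aGL_valP z).
Qed.

Lemma aGL_mul1 : left_id aGL_one aGL_mul.
Proof. by move=> x; apply: aGL_val_inj; exact: aGL_set_mul1 (aGL_valP x). Qed.

Lemma aGL_mulr1 : right_id aGL_one aGL_mul.
Proof. by move=> x; apply: aGL_val_inj; exact: aGL_setr1 (aGL_valP x). Qed.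

Lemma aGL_mulV : left_inverse aGL_one aGL_inv aGL_mul.
Proof.
move=> x; apply: aGL_val_inj; rewrite /aGL_inv.
by case: (cid _) => b [].
Qed.

Lemma aGL_mulrV : right_inverse aGL_one aGL_inv aGL_mul.
Proof.
move=> x; apply: aGL_val_inj; rewrite /aGL_inv.
by case: (cid _) => b [].
Qed.

HB.instance Definition _ := isGroup.Build (aGL L P)
  aGL_mulA aGL_mul1 aGL_mulr1 aGL_mulV aGL_mulrV.

Lemma aGL_valM x y : aGL_val (x * y)%g = matrix_mul L P (aGL_val x) (aGL_val y).
Proof. by []. Qed.

Lemma aGL_val1 : aGL_val 1%g = incidence_one L P.
Proof. by []. Qed.

End aGLGroup.

Definition GL_top (d : Order.disp_t) (L : lfPreorderType d)
    (F : topologicalFieldType) : topologicalType :=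
  set_type (GL L F : set {ptws L * L -> F}).
Arguments GL_top {d} L F.

(* No continuity of the group operations is required: the topology of aGL is
   defined as a final topology, independently of the group structure. *)
HB.structure Definition PreTopologicalGroup := {G of Topological G & Group G}.

Section aGLTopology.
Context {d : Order.disp_t} {L : lfPreorderType d} {F : topologicalFieldType}.

Lemma aGL_incl_subproof (S : {fset L}) (x : GL_top (preorder_plus S) F) :
  aGL_set L F (set_val x).
Proof. by exists S => //; exact: (set_valP x). Qed.

Definition aGL_incl (S : {fset L}) (x : GL_top (preorder_plus S) F) : aGL L F :=
  aGL_of (aGL_incl_subproof x).

(* Openness for the final topology with respect to the inclusions of the
   GL (L + S); see closed_aGLE for closed sets. *)
Definition aGL_open (A : set (aGL L F)) : Prop :=
  forall S : {fset L}, open (@aGL_incl S @^-1` A).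

Lemma aGL_openT : aGL_open setT.
Proof. by move=> S; rewrite preimage_setT; exact: openT. Qed.

Lemma aGL_openI : setI_closed aGL_open.
Proof. by move=> A B oA oB S; rewrite preimage_setI; exact: openI. Qed.

Lemma aGL_open_bigU (I : Type) (f : I -> set (aGL L F)) :
  (forall i, aGL_open (f i)) -> aGL_open (\bigcup_i f i).
Proof.
by move=> of_ S; rewrite preimage_bigcup; apply: bigcup_open => i _; exact: of_.
Qed.

HB.instance Definition _ := isOpenTopological.Build (aGL L F)
  aGL_openT aGL_openI aGL_open_bigU.

Lemma closed_aGLE (A : set (aGL L F)) :
  closed A <-> forall S : {fset L}, closed (@aGL_incl S @^-1` A).
Proof.
split=> [cA S|cA]; rewrite -openC.
  have /(_ S) : aGL_open (~` A) by have : open (~` A) by rewrite openC.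
  by [].
suff : aGL_open (~` A) by [].
move=> S; rewrite preimage_setC openC; exact: cA.
Qed.

End aGLTopology.

Section Subgroups.
Local Open Scope group_scope.

Definition is_subgroup (G : groupType) (H : set G) : Prop :=
  [/\ H 1, (forall x y, H x -> H y -> H (x * y)) & (forall x, H x -> H x^-1)].

Definition is_normal (G : groupType) (H : set G) : Prop :=
  is_subgroup H /\ (forall x g, H x -> H (x ^ g)).

Definition group_center (G : groupType) : set G :=
  [set z | forall x, commute z x].
#[global] Arguments group_center : clear implicits.

Record normalSubgroup (G : groupType) := NormalSubgroup {
  normal_set :> set G;
  normal_setP : is_normal normal_set
}.

Lemma group_center_normal (G : groupType) : is_normal (group_center G).
Proof.
split; first split=> [x|x y zx zy z|x zx z].
- exact/commute_sym/commute1.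
- by apply/commute_sym/commuteM; apply/commute_sym; [exact: zx|exact: zy].
- by apply/commute_sym/commuteV/commute_sym; exact: zx.
- by move=> x g zx; rewrite conjgE (zx g) mulKg.
Qed.

Definition center_normal (G : groupType) : normalSubgroup G :=
  NormalSubgroup (@group_center_normal G).

Section CosetRel.
Context {G : groupType} (N : normalSubgroup G).

Definition coset_rel : rel G := fun x y => `[< (N : set G) (x^-1 * y) >].

Lemma coset_rel_refl : reflexive coset_rel.
Proof. by move=> x; apply/asboolP; rewrite mulVg; case: (normal_setP N) => -[]. Qed.

Lemma coset_rel_sym : symmetric coset_rel.
Proof.
have [[_ _ hV] _] := normal_setP N.
suff H x y : coset_rel x y -> coset_rel y x by move=> x y; apply/idP/idP => /H.
by move=> /asboolP /hV; rewrite invgM invgK => h; apply/asboolP.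
Qed.

Lemma coset_rel_trans : transitive coset_rel.
Proof.
have [[_ hM _] _] := normal_setP N.
move=> y x z /asboolP h1 /asboolP h2; apply/asboolP.
by have := hM _ _ h1 h2; rewrite -mulgA mulVKg.
Qed.

Canonical coset_equiv :=
  EquivRel coset_rel coset_rel_refl coset_rel_sym coset_rel_trans.

End CosetRel.
End Subgroups.

(* Left cosets of N, with the quotient topology. *)
Definition quotg (G : PreTopologicalGroup.type) (N : normalSubgroup G) : Type :=
  quotient_topology {eq_quot (coset_equiv N)}%qT.

Section QuotientGroup.
Local Open Scope group_scope.
Local Open Scope quotient_scope.
Context {G : PreTopologicalGroup.type} {N : normalSubgroup G}.
Local Notation Q := (quotg N).

HB.instance Definition _ := Topological.on Q.
HB.instance Definition _ := Quotient.on Q.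

Definition quotg_one : Q := \pi_Q 1.
Definition quotg_mul (x y : Q) : Q := \pi_Q (repr x * repr y).
Definition quotg_inv (x : Q) : Q := \pi_Q (repr x)^-1.

Lemma quotg_eqP (x y : G) : \pi_Q x = \pi_Q y <-> (N : set G) (x^-1 * y).
Proof.
have e : \pi_Q x = \pi_Q y <-> coset_equiv N x y by split=> [/eqmodP|] // /eqmodP.
by rewrite e; split=> /asboolP.
Qed.

Lemma quotg_reprK (x : G) : (N : set G) (x^-1 * repr (\pi_Q x)).
Proof. by apply/quotg_eqP; rewrite reprK. Qed.

Lemma quotg_piM (x y : G) : quotg_mul (\pi_Q x) (\pi_Q y) = \pi_Q (x * y).
Proof.
have [[_ hM _] hJ] := normal_setP N.
apply/esym/quotg_eqP; have hx := quotg_reprK x; have hy := quotg_reprK y.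
have := hM _ _ (hJ _ y hx) hy.
by rewrite conjgE invgM -!mulgA mulVKg.
Qed.

Lemma quotg_piV (x : G) : quotg_inv (\pi_Q x) = \pi_Q x^-1.
Proof.
have [[_ _ hV] hJ] := normal_setP N.
apply/esym/quotg_eqP; have := hJ _ x^-1 (hV _ (quotg_reprK x)).
by rewrite conjgE invgM !invgK -!mulgA mulgV mulg1.
Qed.

Lemma quotg_mulA : associative quotg_mul.
Proof.
elim/quotW=> x; elim/quotW=> y; elim/quotW=> z.
by rewrite (quotg_piM y z) (quotg_piM x y) (quotg_piM x) quotg_piM mulgA.
Qed.

Lemma quotg_mul1 : left_id quotg_one quotg_mul.
Proof. by elim/quotW=> x; rewrite quotg_piM mul1g. Qed.

Lemma quotg_mulr1 : right_id quotg_one quotg_mul.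
Proof. by elim/quotW=> x; rewrite quotg_piM mulg1. Qed.

Lemma quotg_mulV : left_inverse quotg_one quotg_inv quotg_mul.
Proof. by elim/quotW=> x; rewrite quotg_piV quotg_piM mulVg. Qed.

Lemma quotg_mulrV : right_inverse quotg_one quotg_inv quotg_mul.
Proof. by elim/quotW=> x; rewrite quotg_piV quotg_piM mulgV. Qed.

HB.instance Definition _ := isGroup.Build Q
  quotg_mulA quotg_mul1 quotg_mulr1 quotg_mulV quotg_mulrV.

Lemma quotg_open (A : set Q) : open A <-> open ((\pi_Q : G -> Q) @^-1` A).
Proof. by []. Qed.

Lemma quotg_mulE (x y : G) : \pi_Q x * \pi_Q y = \pi_Q (x * y).
Proof. exact: quotg_piM. Qed.

Lemma quotg_1E : 1 = \pi_Q 1.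
Proof. by []. Qed.

End QuotientGroup.

Definition topologically_simple (G : PreTopologicalGroup.type) : Prop :=
  forall N : set G, is_normal N -> closed N -> N = [set 1%g] \/ N = [set: G].

Definition aPGL (d : Order.disp_t) (L : lfPreorderType d)
    (F : topologicalFieldType) : PreTopologicalGroup.type :=
  quotg (center_normal (aGL L F)).
Arguments aPGL {d} L F.

(* Main.v *)
Require Import Defs.
From HB Require Import structures.
From mathcomp Require Import all_boot all_order all_algebra.
From mathcomp Require Import all_classical.
From mathcomp Require Import finmap topology tvs.
From mathcomp Require Import ring.

(* The center consists of the scalar matrices, a closed condition on the entries.
   Let N be a closed normal subgroup containing a nonscalar g. Iterated
   commutators of g with transvections produce a transvection in N: the images of
   matrix units under conjugation by g have infinite support, but local
   finiteness makes the common support of a column of g and a row of g^-1 finite,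
   and L is infinite. By the commutator relations N contains all transvections,
   and by closedness all dilations diag(e), since these are limits of
   diag(e, e^-1) as the second position goes to infinity. By Gaussian elimination
   N contains all finitary invertible matrices, which are dense. *)

Set Implicit Arguments.
Unset Strict Implicit.
Unset Printing Implicit Defensive.

Local Open Scope classical_set_scope.

(** * The ring of almost incidence matrices and its matrix units *)

Section AlmostIncidenceRing.
Import Order.Theory GRing.Theory.
Local Open Scope ring_scope.
Context {d : Order.disp_t} (L : lfPreorderType d) (P : comNzRingType).
Implicit Types (a b c : L * L -> P) (S : {fset L}).
Local Notation M S := (incidence_ring (preorder_plus S) P).

(* Unlike the union aGL_set of groups, this union of rings L + S is closed under
   addition, and hosts the matrix units and the rank-one perturbations. *)
Definition aM_set : set (L * L -> P) :=
  [set a : L * L -> P | exists S : {fset L}, M S a].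

Lemma incidence_ring_sub S a b : M S a -> M S b -> M S (a - b).
Proof.
move=> Ma Mb s t; apply: contraNT => st.
have -> : (a - b) (s, t) = a (s, t) - b (s, t) by [].
by rewrite (incidence_eq0 Ma st) (incidence_eq0 Mb st) subr0.
Qed.

Lemma incidence_ring_add S a b : M S a -> M S b -> M S (a + b).
Proof.
(* Sums reduce to differences by writing [b] as [- (0 - b)]; what remains is that the zero matrix
   lies in [M S]. *)
move=> Ma Mb; rewrite -[b]opprK -[- b]sub0r.
by do ![apply: incidence_ring_sub => //] => s t; rewrite eqxx.
Qed.

Lemma aM_common2 a b : aM_set a -> aM_set b -> exists S, M S a /\ M S b.
Proof.
move=> [S1 aS1] [S2 bS2]; exists (S1 `|` S2)%fset; split.
  by apply: incidence_ring_plus_sub aS1 => x; rewrite in_fsetU => ->.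
by apply: incidence_ring_plus_sub bS2 => x; rewrite in_fsetU => ->; rewrite orbT.
Qed.

Lemma aM_common3 a b c : aM_set a -> aM_set b -> aM_set c ->
  exists S, [/\ M S a, M S b & M S c].
Proof.
move=> /aM_common2 /[apply] -[S1 [aS1 bS1]] [S2 cS2].
have S1S : {subset S1 <= (S1 `|` S2)%fset} by move=> x; rewrite in_fsetU => ->.
exists (S1 `|` S2)%fset; split.
- exact: incidence_ring_plus_sub aS1.
- exact: incidence_ring_plus_sub bS1.
- by apply: incidence_ring_plus_sub cS2 => x; rewrite in_fsetU => ->; rewrite orbT.
Qed.

Definition aM_pred : {pred L * L -> P} := fun a => a \in aM_set.

Lemma aM_zmod_closed : zmod_closed aM_pred.
Proof.
split=> [|a b].
  by apply/mem_set; exists fset0 => s t; rewrite eqxx.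
move=> /set_mem aM /set_mem bM; apply/mem_set.
have [S [aS bS]] := aM_common2 aM bM.
by exists S; exact: incidence_ring_sub.
Qed.

HB.instance Definition _ :=
  GRing.isZmodClosed.Build (L * L -> P) aM_pred aM_zmod_closed.

Definition aM : Type := {a | aM_pred a}.
HB.instance Definition _ := SubChoice.on aM.
HB.instance Definition _ := [SubChoice_isSubZmodule of aM by <:].

Definition coef (x : aM) (s t : L) : P := val x (s, t).

Definition aM_of a (ha : aM_set a) : aM := exist _ a (mem_set ha).

Lemma aM_valP (x : aM) : aM_set (val x).
Proof. exact/set_mem/(valP x). Qed.

Lemma coef_inj (x y : aM) : (forall s t, coef x s t = coef y s t) -> x = y.
Proof. by move=> xy; apply/val_inj/funext => -[s t]; exact: xy. Qed.

Lemma coefD x y s t : coef (x + y) s t = coef x s t + coef y s t.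
Proof. by []. Qed.

Lemma coefN x s t : coef (- x) s t = - coef x s t.
Proof. by []. Qed.

Lemma aM_set_mul a b : aM_set a -> aM_set b -> aM_set (matrix_mul L P a b).
Proof.
move=> /aM_common2 /[apply] -[S [aS bS]]; exists S.
by rewrite -(plus_mulE aS bS); exact: incidence_mulM.
Qed.

Lemma aM_set1 : aM_set (incidence_one L P).
Proof. exists fset0; exact: (@incidence_one_in _ (preorder_plus fset0)). Qed.

Definition aM_one : aM := aM_of aM_set1.
Definition aM_mul (x y : aM) : aM := aM_of (aM_set_mul (aM_valP x) (aM_valP y)).

(** The three factors lie in one [M S], where the product is that of the incidence ring of [L + S];
    the law is inherited from there. *)
Lemma aM_mulA : associative aM_mul.
Proof.
move=> x y z; apply: val_inj => /=.
have [S [xS yS zS]] := aM_common3 (aM_valP x) (aM_valP y) (aM_valP z).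
rewrite -(plus_mulE yS zS) -(plus_mulE xS yS) -(plus_mulE xS (incidence_mulM yS zS)).
rewrite -(plus_mulE (incidence_mulM xS yS) zS).
exact: (incidence_mulA xS yS zS).
Qed.

Lemma aM_mul1 : left_id aM_one aM_mul.
Proof.
move=> x; apply: val_inj => /=; have [S xS] := aM_valP x.
rewrite -(plus_mulE (@incidence_one_in _ (preorder_plus S) P) xS).
exact: (incidence_mul1r xS).
Qed.

Lemma aM_mulr1 : right_id aM_one aM_mul.
Proof.
move=> x; apply: val_inj => /=; have [S xS] := aM_valP x.
rewrite -(plus_mulE xS (@incidence_one_in _ (preorder_plus S) P)).
exact: (incidence_mulr1 xS).
Qed.

Lemma aM_mulDl : left_distributive aM_mul +%R.
Proof.
move=> x y z; apply: val_inj => /=.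
have [S [xS yS zS]] := aM_common3 (aM_valP x) (aM_valP y) (aM_valP z).
have xyS := incidence_ring_add xS yS.
(* Products are first rewritten as sums over intervals of [L + S]: these are finite, which splitting
   the sum requires. *)
rewrite /GRing.add/= -(plus_mulE xyS zS) -(plus_mulE xS zS) -(plus_mulE yS zS).
apply/funext => -[s t]; rewrite /incidence_mul/=.
rewrite !fsbig_finite; try exact: (@finite_itv _ (preorder_plus S) s t).
rewrite -big_split/=; apply: eq_bigr => r _.
by rewrite -mulrDl.
Qed.

Lemma aM_mulDr : right_distributive aM_mul +%R.
Proof.
move=> z x y; apply: val_inj => /=.
have [S [xS yS zS]] := aM_common3 (aM_valP x) (aM_valP y) (aM_valP z).
have xyS := incidence_ring_add xS yS.
rewrite /GRing.add/= -(plus_mulE zS xyS) -(plus_mulE zS xS) -(plus_mulE zS yS).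
apply/funext => -[s t]; rewrite /incidence_mul/=.
rewrite !fsbig_finite; try exact: (@finite_itv _ (preorder_plus S) s t).
rewrite -big_split/=; apply: eq_bigr => r _.
by rewrite -mulrDr.
Qed.

HB.instance Definition _ := GRing.Zmodule_isPzRing.Build aM
  aM_mulA aM_mul1 aM_mulr1 aM_mulDl aM_mulDr.

Lemma coef1 s t : coef 1 s t = (s == t)%:R.
Proof. by []. Qed.

Lemma coefM x y s t :
  coef (x * y) s t = \sum_(r \in [set: L]) coef x s r * coef y r t.
Proof. by []. Qed.

(** Evaluates products in which a factor is a matrix unit, diagonal, or has a sparse row or
    column. *)
Lemma coefM_single x y s t q :
  (forall r, r != q -> coef x s r * coef y r t = 0) ->
  coef (x * y) s t = coef x s q * coef y q t.
Proof.
move=> h; rewrite coefM -(fsbig_widen [set q])//= ?fsbig_set1//.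
by move=> r [_ /= /eqP]; exact: h.
Qed.

(** No relation between [i] and [j] is required: they become equivalent in [L + S] for [S] the pair
    of them. *)
Lemma elem_subproof i j (c : P) :
  aM_set (fun p : L * L => if p == (i, j) then c else 0).
Proof.
exists [fset i; j]%fset => s t; have [[-> ->] _|_] := eqVneq (s, t) (i, j).
  by apply/asboolP; apply: plus_rel_mem; rewrite in_fset2 eqxx ?orbT.
by rewrite eqxx.
Qed.

Definition elem i j (c : P) : aM := aM_of (elem_subproof i j c).

Lemma coef_elem i j (c : P) s t : coef (elem i j c) s t = (s == i)%:R * c * (t == j)%:R.
Proof.
rewrite /coef/= xpair_eqE.
by case: eqP => _; case: eqP => _; rewrite /= ?(mul0r, mulr0, mul1r, mulr1).
Qed.

Lemma coef_elemM i j (c : P) x s t :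
  coef (elem i j c * x) s t = (s == i)%:R * (c * coef x j t).
Proof.
rewrite (@coefM_single _ _ _ _ j).
  by rewrite coef_elem eqxx mulr1 mulrA.
by move=> r /negPf rj; rewrite coef_elem rj mulr0 mul0r.
Qed.

Lemma coef_Melem i j (c : P) x s t :
  coef (x * elem i j c) s t = coef x s i * c * (t == j)%:R.
Proof.
rewrite (@coefM_single _ _ _ _ i).
  by rewrite coef_elem eqxx mul1r mulrA.
by move=> r /negPf rj; rewrite coef_elem rj !mul0r mulr0.
Qed.

(** Sandwiching between matrix units isolates one entry of [x]; this is what cuts a conjugated
    transvection down to a single entry. *)
Lemma elemMM i j (c : P) x k l (e : P) :
  elem i j c * x * elem k l e = elem i l (c * coef x j k * e).
Proof.
by apply: coef_inj => s t; rewrite coef_Melem coef_elemM coef_elem !mulrA.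
Qed.

Lemma elem0 i j : elem i j 0 = 0.
Proof. by apply: coef_inj => s t; rewrite coef_elem mulr0 mul0r. Qed.

Lemma elemM i j (c : P) k l (e : P) :
  elem i j c * elem k l e = elem i l (c * (j == k)%:R * e).
Proof. by rewrite -[elem i j c]mulr1 elemMM coef1. Qed.

Lemma elemD i j (c e : P) : elem i j (c + e) = elem i j c + elem i j e.
Proof.
by apply: coef_inj => s t; rewrite coefD !coef_elem mulrDr mulrDl.
Qed.

Lemma elemN i j (c : P) : elem i j (- c) = - elem i j c.
Proof.
by apply: coef_inj => s t; rewrite coefN !coef_elem mulrN mulNr.
Qed.

(* Column i of x is supported below i and row j of y above j, so that the common
   support lies in an interval. *)
Lemma finite_common_support x y i j :
  finite_set [set k | coef x k i != 0 /\ coef y j k != 0].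
Proof.
have [S [xS yS]] := aM_common2 (aM_valP x) (aM_valP y).
apply: (sub_finite_set _ (@finite_itv _ (preorder_plus S) j i)) => k /= [xk yk].
by rewrite (yS _ _ yk) (xS _ _ xk).
Qed.

End AlmostIncidenceRing.

(** * Commutators of unipotents with square-zero nilpotent part *)

Section UnipotentCommutator.
Import GRing.Theory.
Local Open Scope ring_scope.
Context {R : pzRingType} (A E : R).
Hypotheses (AA : A * A = 0) (EE : E * E = 0).

Lemma unipotent_inv : (1 + A) * (1 - A) = 1 /\ (1 - A) * (1 + A) = 1.
Proof.
by split; rewrite mulrDl mul1r !(mulrDr, mulr1, mulrN, mulNr) AA ?oppr0 ?addr0
  ?subrK ?addrK.
Qed.

(** The degree two part of the expansion reduces to [A * E - E * A], and each longer monomial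
    contains [A * A], [E * E] or [A * E]. *)
Lemma unipotent_comm_l : A * E = 0 ->
  (1 + A) * (1 + E) * (1 - A) * (1 - E) = 1 - E * A.
Proof.
move=> AE.
have -> : (1 + A) * (1 + E) = 1 + E + A.
  by rewrite mulrDl mul1r mulrDr mulr1 AE addr0.
have -> : (1 + E + A) * (1 - A) = 1 + E - E * A.
  by rewrite mulrBr mulr1 !mulrDl mul1r AA addr0 addrKA.
rewrite mulrBr mulr1 !mulrDl mul1r EE mulNr -(mulrA E A E) AE mulr0 oppr0 !addr0.
by rewrite addrAC addrK.
Qed.

(** The same expansion, with [E * A] now the vanishing product, leaves [A * E]. *)
Lemma unipotent_comm_r : E * A = 0 ->
  (1 + A) * (1 + E) * (1 - A) * (1 - E) = 1 + A * E.
Proof.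
move=> EA.
have e2 : (1 + A) * (1 + E) = 1 + E + A + A * E.
  by rewrite mulrDr mulr1 mulrDl mul1r addrA (addrAC 1 A).
have -> : (1 + A) * (1 + E) * (1 - A) = 1 + E + A * E.
  rewrite e2 mulrBr mulr1 !mulrDl mul1r EA AA -mulrA EA mulr0 !addr0.
  by rewrite addrAC addrK.
by rewrite mulrBr mulr1 !mulrDl mul1r EE -mulrA EE mulr0 !addr0 addrAC addrK.
Qed.

End UnipotentCommutator.

(** * The group as the units of the ring [aM] *)

Section Embedding.
Import GRing.Theory.
Local Open Scope ring_scope.
Context {d : Order.disp_t} {L : lfPreorderType d} {P : comNzRingType}.
Implicit Types (a b : aM L P) (x y : aGL L P).

Lemma aGL_aM_set x : aM_set (aGL_val x).
Proof. by have [S _ [xS _]] := aGL_valP x; exists S. Qed.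

Definition mx x : aM L P := aM_of (aGL_aM_set x).

Lemma mxM x y : mx (x * y)%g = mx x * mx y.
Proof. exact: val_inj. Qed.

Lemma mx1 : mx 1%g = 1.
Proof. exact: val_inj. Qed.

Lemma mxV x : mx x^-1%g * mx x = 1.
Proof. by rewrite -mxM mulVg mx1. Qed.

Lemma mxVr x : mx x * mx x^-1%g = 1.
Proof. by rewrite -mxM mulgV mx1. Qed.

Lemma mx_inj : injective mx.
Proof. by move=> x y /(congr1 val) /= xy; exact: aGL_val_inj. Qed.

Lemma coef_mx x s t : coef (mx x) s t = aGL_val x (s, t).
Proof. by []. Qed.

(** A unit and its inverse lie in a common [M S], so the unit already belongs to the group of units
    of that incidence ring. *)
Lemma mx_lift a b : a * b = 1 -> b * a = 1 ->
  exists x, mx x = a /\ mx x^-1%g = b.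
Proof.
move=> ab ba.
have [S [aS bS]] := aM_common2 (aM_valP a) (aM_valP b).
have aG : aGL_set L P (val a).
  exists S => //; split=> //; exists (val b) => //.
  by rewrite (plus_mulE aS bS) (plus_mulE bS aS); split;
    [exact: (congr1 val ab)|exact: (congr1 val ba)].
exists (aGL_of aG); have ea : mx (aGL_of aG) = a by exact: val_inj.
by split=> //; rewrite -[RHS]mul1r -(mxV (aGL_of aG)) ea -mulrA ab mulr1.
Qed.

Lemma elem_sq i j (c : P) : i != j -> elem i j c * elem i j c = 0 :> aM L P.
Proof. by rewrite eq_sym elemM => /negPf ->; rewrite mulr0 mul0r elem0. Qed.

Lemma elem_lift i j (c : P) : i != j ->
  exists x, mx x = 1 + elem i j c /\ mx x^-1%g = 1 - elem i j c.
Proof.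
by move=> ij; apply: mx_lift; have [] := unipotent_inv (elem_sq c ij).
Qed.

End Embedding.

(** * Normal subgroups seen inside the ring *)

Section NormalSubgroup.
Import GRing.Theory.
Local Open Scope ring_scope.
Context {d : Order.disp_t} {L : lfPreorderType d} {P : comNzRingType}.
Context (N : set (aGL L P)).
Implicit Types (a b : aM L P) (x y g h : aGL L P).

(** Membership is stated for ring elements, so that additive expressions such as [1 + elem i j c]
    can be handled by ring identities. *)
Definition mx_mem a : Prop := exists2 x, N x & mx x = a.

Hypothesis subN : is_subgroup N.

Lemma mx_mem1 : mx_mem 1.
Proof. by have [N1 _ _] := subN; exists 1%g => //; rewrite mx1. Qed.

Lemma mx_memM a b : mx_mem a -> mx_mem b -> mx_mem (a * b).
Proof.
have [_ NM _] := subN.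
by move=> [x Nx <-] [y Ny <-]; exists (x * y)%g; [exact: NM|rewrite mxM].
Qed.

Lemma mx_memV a b : b * a = 1 -> mx_mem a -> mx_mem b.
Proof.
have [_ _ NV] := subN.
move=> + [x Nx xa]; rewrite -xa => ba; exists x^-1%g; first exact: NV.
by rewrite -[LHS]mul1r -ba -mulrA mxVr mulr1.
Qed.

Lemma mx_memMl a b c : c * a = 1 -> mx_mem a -> mx_mem (a * b) -> mx_mem b.
Proof.
by move=> ca aN /(mx_memM (mx_memV ca aN)); rewrite mulrA ca mul1r.
Qed.

Lemma mx_memMr a b c : c * b = 1 -> b * c = 1 -> mx_mem b -> mx_mem (a * b) -> mx_mem a.
Proof.
move=> cb bc bN /mx_memM /(_ (mx_memV cb bN)).
by rewrite -mulrA bc mulr1.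
Qed.

Hypothesis normN : forall x g, N x -> N (x ^ g)%g.

Lemma normal_comm x h : N x -> N (x * h * x^-1 * h^-1)%g.
Proof.
have [_ NM NV] := subN.
move=> Nx; have := NM _ _ Nx (normN h^-1%g (NV _ Nx)).
by rewrite conjgE invgK !mulgA.
Qed.

Lemma mx_mem_comm a a' b b' : a * a' = 1 -> a' * a = 1 -> b * b' = 1 -> b' * b = 1 ->
  mx_mem a -> mx_mem (a * b * a' * b').
Proof.
move=> aa' a'a bb' b'b [x Nx xa].
have [h [hb hb']] := mx_lift bb' b'b.
have xa' : mx x^-1%g = a'.
  by rewrite -[LHS]mul1r -a'a -mulrA -xa mxVr mulr1.
exists (x * h * x^-1 * h^-1)%g; first exact: normal_comm.
by rewrite !mxM xa xa' hb hb'.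
Qed.

Lemma mx_mem_comm_l a b : a * a = 0 -> b * b = 0 -> a * b = 0 ->
  mx_mem (1 + a) -> mx_mem (1 - b * a).
Proof.
move=> aa bb ab; rewrite -(unipotent_comm_l aa bb ab).
by have [? ?] := unipotent_inv aa; have [? ?] := unipotent_inv bb; exact: mx_mem_comm.
Qed.

Lemma mx_mem_comm_r a b : a * a = 0 -> b * b = 0 -> b * a = 0 ->
  mx_mem (1 + a) -> mx_mem (1 + a * b).
Proof.
move=> aa bb ab; rewrite -(unipotent_comm_r aa bb ab).
by have [? ?] := unipotent_inv aa; have [? ?] := unipotent_inv bb; exact: mx_mem_comm.
Qed.

End NormalSubgroup.

(** * Transvections in a normal subgroup with a nonscalar element *)

Lemma comm_divg (G : groupType) (y x h : G) : (x * h = h * x)%g ->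
  (y * h * y^-1 * h^-1 = (y * x^-1) * h * (y * x^-1)^-1 * h^-1)%g.
Proof.
move=> xh; congr (_ * _)%g.
by rewrite invgM invgK !mulgA -(mulgA (y * x^-1) h x)%g -xh mulgA mulgVK.
Qed.

Lemma infinite_notin (T : choiceType) (A : set T) (r : seq T) :
  infinite_set [set: T] -> finite_set A -> exists2 k, ~ A k & k \notin r.
Proof.
move=> infT finA; apply: contrapT => noK; apply: infT.
apply: (@sub_finite_set _ _ (A `|` [set` r])).
  move=> k _; apply: contrapT => /not_orP[Ak rk]; apply: noK; exists k => //.
  by apply/negP => kr; exact: rk.
by rewrite finite_setU; split=> //; exact: finite_seq.
Qed.

Section Transvections.
Import GRing.Theory.
Local Open Scope ring_scope.
Context {d : Order.disp_t} {L : lfPreorderType d} {F : fieldType}.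
Context (L_infinite : infinite_set [set: L]).
Context (N : set (aGL L F)) (normN : is_normal N).
Implicit Types (a b : aM L F) (x y g h : aGL L F).

Definition is_scalar a : Prop :=
  (forall s t, s != t -> coef a s t = 0) /\ (forall s t, coef a s s = coef a t t).

Let notin (r : seq L) : exists k, k \notin r.
Proof. by have [k _ kr] := infinite_notin r L_infinite (finite_set0 L); exists k. Qed.

(** Entry [(s, j)] of the relation for [elem t j 1] kills [coef a s t], and entry [(s, t)] of the
    relation for [elem s t 1] equates two diagonal entries. Only off-diagonal units are used, as
    these come from transvections. *)
Lemma is_scalarP a :
  (forall i j, i != j -> a * elem i j 1 = elem i j 1 * a) -> is_scalar a.
Proof.
move=> ca.
have ca' s t i j : i != j ->
    coef a s i * 1 * (t == j)%:R = (s == i)%:R * (1 * coef a j t).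
  by move=> ij; rewrite -coef_Melem -coef_elemM ca.
split=> [s t st|s t].
  have [j] := notin [:: t]; rewrite !inE eq_sym => tj.
  by have := ca' s j t j tj; rewrite eqxx (negPf st) mul0r !mulr1.
have [->//|st] := eqVneq s t.
by have := ca' s t s t st; rewrite !eqxx !mul1r !mulr1.
Qed.

(* With x = 1 + b and h = 1 + e, which commute, and y = g x g^-1, the double
   commutator [[g, x], h] equals [y, h], although y itself need not be in N. *)
Lemma mx_mem_double_comm g a a' b (e : aM L F) :
  N g -> mx g = a -> mx g^-1%g = a' -> b * b = 0 -> e * e = 0 ->
  b * e = 0 -> e * b = 0 ->
  mx_mem N ((1 + a * b * a') * (1 + e) * (1 - a * b * a') * (1 - e)).
Proof.
have [subN conjN] := normN.
move=> Ng ga ga' bb ee be eb.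
have [bi ib] := unipotent_inv bb; have [ei ie] := unipotent_inv ee.
have [x [xb xb']] := mx_lift bi ib; have [h [he he']] := mx_lift ei ie.
have aa' : a * a' = 1 by rewrite -ga -ga' mxVr.
have xh : (x * h = h * x)%g.
  apply: mx_inj; rewrite !mxM xb he !mulrDl !mulrDr !mul1r !mulr1 be eb !addr0.
  by rewrite addrAC.
pose y : aGL L F := (g * x * g^-1)%g.
have yb : mx y = 1 + a * b * a'.
  by rewrite !mxM xb ga ga' mulrDr mulr1 mulrDl aa'.
have yb' : mx y^-1%g = 1 - a * b * a'.
  by rewrite !invgM invgK !mxM xb' ga ga' mulrA mulrBr mulr1 mulrBl aa'.
exists (y * h * y^-1 * h^-1)%g; last first.
  by rewrite (mxM (y * h * y^-1)%g) (mxM (y * h)%g) (mxM y) yb yb' he he'.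
rewrite (comm_divg y xh).
exact: (normal_comm subN conjN h (normal_comm subN conjN x Ng)).
Qed.

(** Conjugation by a diagonal matrix scales the matrix unit at [(i, j)] by the ratio [q] of diagonal
    entries, so the commutator with [1 + elem i j 1] is [1 + elem i j (q - 1)]. *)
Lemma transvection_of_diag g : N g ->
  (forall s t, s != t -> coef (mx g) s t = 0) ->
  ~ (forall s t, coef (mx g) s s = coef (mx g) t t) ->
  exists i j c, [/\ i != j, c != 0 & mx_mem N (1 + elem i j c)].
Proof.
have [subN conjN] := normN.
move=> Ng dg /existsNP[i] /existsNP[j] /eqP gij; set a := mx g in dg gij.
have ij : i != j by apply: contra gij => /eqP ->.
have ajj : coef a j j != 0.
  have := @coef1 _ L F j j; rewrite eqxx -(mxV g) (@coefM_single _ _ _ _ _ j j j) => [e|r rj].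
    by apply/eqP => a0; move: e; rewrite a0 mulr0 => /eqP; rewrite eq_sym oner_eq0.
  by rewrite dg// mulr0.
pose q := coef a i i / coef a j j.
exists i, j, (q - 1); split=> //.
  by rewrite subr_eq0; apply: contra gij => /eqP q1; rewrite -[coef a i i](divfK ajj) -/q q1 mul1r.
have [x [xe xe']] := elem_lift (1 : F) ij.
exists (g * x * g^-1 * x^-1)%g; first exact: normal_comm.
have eq1 : a * elem i j 1 = elem i j q * a.
  apply: coef_inj => s t; rewrite coef_Melem coef_elemM mulr1.
  have [->|tj] := eqVneq t j; rewrite ?mulr1 ?mulr0; last first.
    by rewrite (dg j t) 1?eq_sym// !mulr0.
  rewrite divfK//; have [->|si] := eqVneq s i; first by rewrite mul1r.
  by rewrite mul0r dg.
rewrite !mxM xe xe' -/a (mulrDr a) mulr1 (mulrDl a) mxVr eq1 -mulrA mxVr mulr1.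
rewrite mulrBr mulr1 mulrDl mul1r elemM eq_sym (negPf ij) mulr0 mul0r elem0 addr0.
by rewrite elemD elemN addrA.
Qed.

(* A = a E_ij a^-1 is the product of column i of a and row j of a^-1. These have
   finite common support, so that some k far away is missing from one of them:
   then E_kl or E_nk is annihilated by A on one side, and two commutators with
   transvections cut A down to a multiple of a single matrix unit. *)
Lemma transvection_of_nondiag g i l : N g -> l != i -> coef (mx g) l i != 0 ->
  exists i j c, [/\ i != j, c != 0 & mx_mem N (1 + elem i j c)].
Proof.
have [subN conjN] := normN.
move=> Ng li gli; set a := mx g in gli; pose a' := mx g^-1%g.
have [j] := notin [:: i; l]; rewrite !inE negb_or => /andP[ji jl].
pose X := elem i j (1 : F) : aM L F; pose A := a * X * a'.
have XX : X * X = 0 by rewrite elem_sq// eq_sym.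
have AA : A * A = 0.
  by rewrite /A !mulrA -(mulrA (a * X)) mxV mulr1 -(mulrA a) XX mulr0 mul0r.
have eA k t c : elem k t c * A = elem k j (c * coef a t i) * a'.
  by rewrite /A (mulrA _ (a * X)) (mulrA _ a) /X elemMM mulr1.
have eAe k t c m n e : elem k t c * A * elem m n e = elem k n (c * coef a t i * coef a' j m * e).
  by rewrite eA elemMM.
have [m a'm] : exists m, coef a' j m != 0.
  apply: contrapT => /forallNP a'0.
  have := @coef1 _ L F j j; rewrite eqxx -(mxV g) (@coefM_single _ _ _ _ _ j j j).
    have /negP/negPn/eqP := a'0 j; rewrite /a' => ->.
    by rewrite mul0r => /eqP; rewrite eq_sym oner_eq0.
  by move=> r _; have /negP/negPn/eqP := a'0 r; rewrite /a' => ->; rewrite mul0r.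
have caseL k : k \notin [:: i; j; l] -> coef a' j k = 0 ->
    exists i j c, [/\ i != j, c != 0 & mx_mem N (1 + elem i j c)].
  rewrite !inE !negb_or => /and3P[ki kj kl] a'k.
  (* Here [A * E = 0], and [1 - E * A] differs from the identity only in row [k]; multiplication by
     [E'] keeps the entry in column [m], nonzero by the choice of [l] and [m]. *)
  pose E := elem k l (1 : F) : aM L F.
  have EE : E * E = 0 by rewrite elem_sq.
  have AE : A * E = 0.
    by rewrite /A -mulrA -(mulrA a) mulrA -(mulrA a) /X /E (mulrA (elem i j 1))
      elemMM a'k mulr0 mul0r elem0 mulr0.
  have XE : X * E = 0 by rewrite elemM eq_sym (negPf kj) mulr0 mul0r elem0.
  have EX : E * X = 0 by rewrite elemM (negPf li) mulr0 mul0r elem0.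
  have := mx_mem_double_comm Ng (erefl a) (erefl a') XX EE XE EX.
  rewrite unipotent_comm_l// -/A => mem1.
  have mk : m != k by apply: contra a'm => /eqP ->; rewrite a'k.
  have [p] := notin [:: m; k]; rewrite !inE negb_or => /andP[pm pk].
  pose E' := elem m p (1 : F) : aM L F.
  have E'E' : E' * E' = 0 by rewrite elem_sq// eq_sym.
  have E'B : E' * (- (E * A)) = 0.
    by rewrite mulrN mulrA elemM (negPf pk) mulr0 mul0r elem0 mul0r oppr0.
  have BB : - (E * A) * - (E * A) = 0.
    by rewrite mulrNN mulrA -(mulrA E A E) AE mulr0 mul0r.
  have := mx_mem_comm_r subN conjN BB E'E' E'B mem1.
  rewrite mulNr eAe -elemN => mem2; exists k, p; eexists; split; [|  |exact: mem2].
    by rewrite eq_sym.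
  by rewrite oppr_eq0 mulr1 mul1r mulf_neq0.
(* If row [j] of [a'] is zero away from [j], any new [k] falls under [caseL]; otherwise finiteness
   of the common support provides [k]. *)
have [nE|/existsNP[n /not_implyP[nj a'n]]] :=
    pselect (forall n, n != j -> coef a' j n = 0).
  have [k kn] := notin [:: i; j; l]; apply: (caseL k) => //.
  by apply: nE; move: kn; rewrite !inE !negb_or => /and3P[].
have [k] := infinite_notin [:: i; j; l; n] L_infinite (finite_common_support a a' i j).
rewrite !inE !negb_or => nk /and4P[ki kj kl kn].
have [a'k|a'k] := eqVneq (coef a' j k) 0.
  by apply: (caseL k) => //; rewrite !inE !negb_or ki kj kl.
have ak : coef a k i = 0 by apply: contrapT => /eqP ak; apply: nk.
(* Now column [i] of [a] misses [k], so [E * A = 0] and [A * E] lives in column [k]. Taking [n]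
   different from [j] makes [X * E = 0], and [E'] then selects row [l]. *)
pose E := elem n k (1 : F) : aM L F.
have EE : E * E = 0 by rewrite elem_sq// eq_sym.
have EA : E * A = 0 by rewrite eA ak mulr0 elem0 mul0r.
have XE : X * E = 0 by rewrite elemM eq_sym (negPf nj) mulr0 mul0r elem0.
have EX : E * X = 0 by rewrite elemM (negPf ki) mulr0 mul0r elem0.
have := mx_mem_double_comm Ng (erefl a) (erefl a') XX EE XE EX.
rewrite unipotent_comm_r// -/A => mem1.
have [p] := notin [:: l; k]; rewrite !inE negb_or => /andP[pl pk].
pose E' := elem p l (1 : F) : aM L F.
have E'E' : E' * E' = 0 by rewrite elem_sq.
have BE' : A * E * E' = 0.
  by rewrite -mulrA elemM eq_sym (negPf pk) mulr0 mul0r elem0 mulr0.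
have BB : A * E * (A * E) = 0 by rewrite mulrA -(mulrA A) EA mulr0 mul0r.
have := mx_mem_comm_l subN conjN BB E'E' BE' mem1.
rewrite mulrA eAe -elemN => mem2; exists p, k; eexists; split; [| |exact: mem2] => //.
by rewrite oppr_eq0 mulr1 mul1r mulf_neq0//; apply/eqP.
Qed.

Lemma transvection_of_nonscalar g : N g -> ~ is_scalar (mx g) ->
  exists i j c, [/\ i != j, c != 0 & mx_mem N (1 + elem i j c)].
Proof.
move=> Ng /not_andP[/existsNP[l] /existsNP[i] /not_implyP[li /eqP]|].
  exact: transvection_of_nondiag.
have [dg|] := pselect (forall s t, s != t -> coef (mx g) s t = 0).
  exact: transvection_of_diag.
move=> /existsNP[l] /existsNP[i] /not_implyP[li /eqP] + _.
exact: transvection_of_nondiag.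
Qed.

(** Commutators change one index at a time, along [(i, j)], [(i, k)], [(l, k)], [(l, t)], [(s, t)].
    The fresh [k] and [l] keep each triple distinct even if the two pairs overlap; the first move
    normalizes the coefficient to 1, the last sets it to [e]. *)
Lemma transvection_all i j c : i != j -> c != 0 -> mx_mem N (1 + elem i j c) ->
  forall s t e, s != t -> mx_mem N (1 + elem s t e).
Proof.
have [subN conjN] := normN.
have chgr s t u (c0 e : F) : uniq [:: s; t; u] -> mx_mem N (1 + elem s t c0) ->
    mx_mem N (1 + elem s u (c0 * e)).
  rewrite /= !inE negb_or !andbT => /andP[/andP[st su] tu] /(mx_mem_comm_r subN conjN).
  move=> /(_ (elem t u e)); rewrite !elem_sq// elemM [u == s]eq_sym (negPf su) mulr0 mul0r elem0.
  by rewrite elemM eqxx mulr1 => /(_ erefl erefl erefl).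
have chgl s t u (c0 e : F) : uniq [:: s; t; u] -> mx_mem N (1 + elem s t c0) ->
    mx_mem N (1 + elem u t (e * c0)).
  rewrite /= !inE negb_or !andbT => /andP[/andP[st su] tu] /(mx_mem_comm_l subN conjN).
  move=> /(_ (elem u s (- e))); rewrite !elem_sq// 1?eq_sym// elemM (negPf tu) mulr0 mul0r elem0.
  by rewrite elemM eqxx mulr1 -elemN mulNr opprK => /(_ erefl erefl erefl).
move=> ij c0 mem s t e st.
have [k] := notin [:: i; j; s; t]; rewrite !inE !negb_or => /and4P[ki kj ks kt].
have [l] := notin [:: i; k; s; t]; rewrite !inE !negb_or => /and4P[li lk ls lt].
have mik : mx_mem N (1 + elem i k 1).
  rewrite -(divff c0); apply: (chgr _ j) => //=.
  by rewrite !inE negb_or ij [i == k]eq_sym [j == k]eq_sym ki kj.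
have mlk : mx_mem N (1 + elem l k 1).
  have := @chgl i k l 1 1; rewrite mulr1; apply=> //=.
  by rewrite !inE negb_or ![_ == k]eq_sym [_ == l]eq_sym ki [k == l]eq_sym lk li.
have mlt : mx_mem N (1 + elem l t 1).
  have := @chgr l k t 1 1; rewrite mulr1; apply=> //=.
  by rewrite !inE negb_or lk lt kt.
have := @chgl l t s 1 e; rewrite mulr1; apply=> //=.
by rewrite !inE negb_or lt ls eq_sym st.
Qed.

End Transvections.

(** * Gaussian elimination for finitary matrices *)

Lemma mulr_inv2 (R : pzRingType) (x x' y y' : R) :
  (x * x' = 1 -> y * y' = 1 -> (x * y) * (y' * x') = 1)%R.
Proof. by move=> xx' yy'; rewrite GRing.mulrA -(GRing.mulrA x) yy' GRing.mulr1. Qed.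

Section Elimination.
Import GRing.Theory.
Local Open Scope ring_scope.
Context {d : Order.disp_t} {L : lfPreorderType d} {F : fieldType}.
Context (N : set (aGL L F)) (subN : is_subgroup N).
Implicit Types (a b : aM L F).
Hypothesis transvN : forall s t e, s != t -> mx_mem N (1 + elem s t e).

Definition finitary (T : seq L) a : Prop :=
  forall s t, ~~ ((s \in T) && (t \in T)) -> coef a s t = (s == t)%:R.

Lemma coef_sum (I : Type) (r : seq I) (f : I -> aM L F) s t :
  coef (\sum_(i <- r) f i) s t = \sum_(i <- r) coef (f i) s t.
Proof. by elim/big_ind2 : _ => // x u y v <- <-. Qed.

Lemma coef_transvM i j c a s t :
  coef ((1 + elem i j c) * a) s t = coef a s t + (s == i)%:R * (c * coef a j t).
Proof. by rewrite mulrDl mul1r coefD coef_elemM. Qed.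

Lemma sum_delta (r : seq L) (f : L -> F) s : uniq r ->
  \sum_(u <- r) (s == u)%:R * f u = (s \in r)%:R * f s.
Proof.
elim: r => [|u r IH /= /andP[ur /IH{}IH]]; first by rewrite big_nil in_nil mul0r.
rewrite big_cons IH inE; have [->|] := eqVneq s u; last by rewrite mul0r add0r.
by rewrite (negPf ur) mul0r addr0.
Qed.

(** All products of the summands vanish, so the matrix is a product of transvections; with [h] or
    [f] constant it clears a column or a row at once. *)
Lemma mx_mem_sum_elem (r : seq L) (f h : L -> L) (c : L -> F) :
  (forall u v, u \in r -> v \in r -> h u != f v) ->
  mx_mem N (1 + \sum_(u <- r) elem (f u) (h u) (c u)).
Proof.
elim: r => [_|u r IH hf]; first by rewrite big_nil addr0; exact: mx_mem1.
have hfr : forall v, v \in r -> h u != f v.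
  by move=> v vr; apply: hf; rewrite inE ?eqxx// vr orbT.
have -> : 1 + \sum_(i <- u :: r) elem (f i) (h i) (c i) =
    (1 + elem (f u) (h u) (c u)) * (1 + \sum_(i <- r) elem (f i) (h i) (c i)).
  rewrite mulrDr mulr1 mulrDl mul1r big_cons mulr_sumr [X in _ = _ + (_ + X)]big_seq.
  rewrite [X in _ = _ + (_ + X)]big1 ?addr0 ?addrA// => v vr.
  by rewrite elemM (negPf (hfr v vr)) mulr0 mul0r elem0.
apply: mx_memM => //.
  by apply: transvN; rewrite eq_sym; apply: hf; rewrite inE eqxx.
by apply: IH => v w vr wr; apply: hf; rewrite inE ?vr ?wr orbT.
Qed.

Hypothesis dilN : forall s (e : F), e != 0 -> mx_mem N (1 + elem s s (e - 1)).

(** The matrix [1 + elem s s (e - 1)] is diagonal, with [e] at [s] and ones elsewhere. *)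
Lemma dilation_inv (s : L) (e : F) : e != 0 ->
  (1 + elem s s (e - 1)) * (1 + elem s s (e^-1 - 1)) = 1 :> aM L F.
Proof.
move=> e0; rewrite mulrDr mulr1 mulrDl mul1r elemM eqxx mulr1 -addrA -!elemD.
rewrite (_ : _ + (_ + _) = 0) ?elem0 ?addr0//.
by field.
Qed.

(* Gaussian elimination with pivot s, by induction on the support. *)
Lemma mx_mem_finitary (T : seq L) a b : uniq T -> a * b = 1 -> b * a = 1 ->
  finitary T a -> mx_mem N a.
Proof.
elim: T a b => [a b _ ab ba aT|s T IH].
  have -> : a = 1 by apply: coef_inj => s t; exact: aT.
  exact: mx_mem1.
suff pivot a b : uniq (s :: T) -> a * b = 1 -> b * a = 1 -> finitary (s :: T) a ->
    coef a s s != 0 -> mx_mem N a.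
  move=> a b uT ab ba aT.
  have [ass|] := eqVneq (coef a s s) 0; last exact: (pivot _ b).
  (* A zero pivot is repaired by adding to row [s] a row [t] that is nonzero in column [s]; it
     exists because [b * a = 1]. *)
  have [t ats] : exists t, coef a t s != 0.
    apply: contrapT => /forallNP a0.
    have := @coef1 _ L F s s; rewrite eqxx -ba (@coefM_single _ _ _ _ _ s s s).
      have /negP/negPn/eqP -> := a0 s.
      by rewrite mulr0 => /eqP; rewrite eq_sym oner_eq0.
    by move=> r _; have /negP/negPn/eqP -> := a0 r; rewrite mulr0.
  have st : s != t by apply: contra ats => /eqP <-; rewrite ass.
  have tT : t \in s :: T.
    apply: contraNT ats => tT; rewrite aT ?(negPf tT)//.
    by rewrite [t == s]eq_sym (negPf st).
  have [e1 e2] := unipotent_inv (elem_sq (1 : F) st).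
  apply: (mx_memMl subN e2 (transvN _ st)).
  apply: (pivot _ (b * (1 - elem s t 1))) => //.
  - by rewrite mulrA -(mulrA _ a) ab mulr1.
  - by rewrite mulrA -(mulrA b) e2 mulr1.
  - move=> x y xy; rewrite coef_transvM mul1r aT//.
    have [xs|] := eqVneq x s; last by rewrite mul0r addr0.
    move: xy; rewrite xs inE eqxx/= => yT.
    rewrite aT ?(negPf yT) ?andbF// (_ : (t == y) = false) ?mul1r ?addr0//.
    by apply: contraNF yT => /eqP <-.
  - by rewrite coef_transvM ass add0r eqxx !mul1r.
move=> /= /andP[sT uT] ab ba aT p0; set p := coef a s s in p0.
(* Left multiplication by [1 + r] clears column [s], right multiplication by [1 + q] clears row [s],
   and [D] scales the pivot to 1, leaving a matrix finitary on [T]. *)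
pose r := \sum_(u <- T) elem u s (- (coef a u s / p)) : aM L F.
pose q := \sum_(u <- T) elem s u (- (coef a s u / p)) : aM L F.
have rN : mx_mem N (1 + r).
  by apply: mx_mem_sum_elem => u v _ vT; apply: contraNneq sT => ->.
have qN : mx_mem N (1 + q).
  by apply: mx_mem_sum_elem => u v uT' _; apply: contraNneq sT => <-.
have [r' [r'r rr']] : exists r', r' * (1 + r) = 1 /\ (1 + r) * r' = 1.
  have [x _ <-] := rN.
  by exists (mx x^-1%g); rewrite mxV mxVr.
have [q' [q'q qq']] : exists q', q' * (1 + q) = 1 /\ (1 + q) * q' = 1.
  have [x _ <-] := qN.
  by exists (mx x^-1%g); rewrite mxV mxVr.
apply: (mx_memMl subN r'r rN).
apply: (mx_memMr subN q'q qq' qN).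
have d1 := dilation_inv s p0.
have d2 := @dilation_inv s p^-1; rewrite invrK in d2.
have {}d2 := d2 (invr_neq0 p0).
apply: (mx_memMl subN d1 (dilN s (invr_neq0 p0))).
set D := 1 + elem s s (p^-1 - 1) in d1 d2 *; set D' := 1 + elem s s (p - 1) in d1 d2.
apply: (IH _ (q' * (b * r') * D')) => //.
- exact: (mulr_inv2 d2 (mulr_inv2 (mulr_inv2 rr' ab) qq')).
- exact: (mulr_inv2 (mulr_inv2 q'q (mulr_inv2 ba r'r)) d1).
have rE x y : coef ((1 + r) * a) x y = coef a x y - (x \in T)%:R * (coef a x s / p * coef a s y).
  rewrite mulrDl mul1r coefD mulr_suml coef_sum -mulrN -mulNr.
  rewrite -(sum_delta (fun x => - (coef a x s / p) * coef a s y))//.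
  by congr (_ + _); apply: eq_bigr => u _; rewrite coef_elemM.
have qE x y c : coef (c * (1 + q)) x y = coef c x y - coef c x s * (coef a s y / p) * (y \in T)%:R.
  rewrite mulrDr mulr1 coefD mulr_sumr coef_sum [_ * (y \in T)%:R]mulrC -mulrN -mulrN.
  rewrite -(sum_delta (fun y => coef c x s * - (coef a s y / p)))//.
  by congr (_ + _); apply: eq_bigr => u _; rewrite coef_Melem mulrC.
pose c := (1 + r) * a.
have rs x : x != s -> coef c x s = 0.
  move=> xs; rewrite rE divfK//; have [xT|xT] := boolP (x \in T).
    by rewrite mul1r subrr.
  by rewrite mul0r subr0 aT ?(negPf xs)// inE (negPf xs) (negPf xT).
have rss y : coef c s y = coef a s y by rewrite rE (negPf sT) mul0r subr0.
move=> x y xy; rewrite /D coef_transvM -/c (qE x y c) (qE s y c).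
have [->|xs] := eqVneq x s.
  rewrite !rss -/p [p * _]mulrC divfK// mul1r mulrBl mul1r subrKC.
  have [yT|yT] := boolP (y \in T).
    by rewrite mulr1 subrr mulr0; case: eqP => // sy; rewrite sy yT in sT.
  rewrite mulr0 subr0; have [<-|sy] := eqVneq s y; first by rewrite mulVf.
  by rewrite aT ?(negPf sy) ?mulr0// !inE eqxx/= eq_sym (negPf sy) (negPf yT).
rewrite mul0r addr0 (rs x xs) !mul0r subr0 /c rE.
have [xT|xT] := boolP (x \in T); last first.
  by rewrite mul0r subr0 aT// inE (negPf xs) (negPf xT).
have yT : y \notin T by move: xy; rewrite xT.
have [ys|ys] := eqVneq y s.
  by rewrite ys divfK// mul1r subrr (negPf xs).
have ysT : y \notin s :: T by rewrite inE (negPf ys).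
rewrite (aT x y) ?(negPf ysT) ?andbF// (aT s y) ?(negPf ysT) ?andbF//.
by rewrite [s == y]eq_sym (negPf ys) !mulr0 subr0.
Qed.

End Elimination.

(** * Approximation on finitely many entries *)

Lemma nbhs_ptws_finite (K : choiceType) (V : topologicalType)
    (g : {ptws K -> V}) (B : set {ptws K -> V}) : nbhs g B ->
  exists T : {fset K}, forall h : K -> V, (forall k, k \in T -> h k = g k) -> B h.
Proof.
pose G (T : {fset K}) : set {ptws K -> V} :=
  [set h | forall k, k \in T -> h k = g k].
have FG : Filter (filter_from setT G).
  apply: filter_fromT_filter; first by exists fset0.
  move=> T1 T2; exists (T1 `|` T2)%fset => h hG; split=> k kT.
    by apply: hG; rewrite in_fsetU kT.
  by apply: hG; rewrite in_fsetU kT orbT.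
(* The pointwise topology is a supremum over coordinates, so convergence is tested on one
   coordinate, where a singleton [T] suffices. *)
suff /[apply] : filter_from setT G --> g.
  by move=> [T _ TB]; exists T => h hT; exact: TB.
apply/cvg_sup => k B' [_ [[U oU <-] Ug UB']].
exists [fset k]%fset => //= h hk; apply: UB' => /=.
by rewrite /proj hk ?in_fset1.
Qed.

Section Approximation.
Import GRing.Theory.
Local Open Scope ring_scope.
Context {d : Order.disp_t} {L : lfPreorderType d} {F : topologicalFieldType}.
Context (N : set (aGL L F)) (closedN : closed N).
Implicit Types (S T : {fset L}) (g h : aGL L F).
Local Notation G S := (GL (preorder_plus S) F).

(** In the final topology [N] is closed in each GL of [L + S]. The approximants must therefore share
    one [S] with [g], and there a neighbourhood contains every matrix agreeing with [g] on some
    finite set of entries. *)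
Lemma closed_approx g S : G S (aGL_val g) ->
  (forall T, exists h, [/\ N h, G S (aGL_val h) &
     forall s t, s \in T -> t \in T -> aGL_val h (s, t) = aGL_val g (s, t)]) ->
  N g.
Proof.
move=> gS approx.
pose g' : GL_top (preorder_plus S) F := exist _ (aGL_val g) (mem_set gS).
have eg : aGL_incl g' = g by exact: aGL_val_inj.
rewrite -eg; move/closed_aGLE : closedN => /(_ S); apply => B [_ [[U oU <-] Ug UB]].
have [T TU] := nbhs_ptws_finite (open_nbhs_nbhs (conj oU Ug)).
have [h [Nh hS hg]] := approx ([fset p.1 | p in T] `|` [fset p.2 | p in T])%fset.
pose h' : GL_top (preorder_plus S) F := exist _ (aGL_val h) (mem_set hS).
exists h'; split.
  by rewrite /preimage/= (_ : aGL_incl h' = h)//; exact: aGL_val_inj.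
apply: UB; apply: TU => -[s t] stT; apply: hg.
  by rewrite in_fsetU; apply/orP; left; apply/imfsetP; exists (s, t).
by rewrite in_fsetU; apply/orP; right; apply/imfsetP; exists (s, t).
Qed.

End Approximation.

(** * Dilations, and density of the finitary matrices *)

Section Density.
Import Order.Theory GRing.Theory.
Local Open Scope ring_scope.
Context {d : Order.disp_t} {L : lfPreorderType d} {F : topologicalFieldType}.
Context (L_infinite : infinite_set [set: L]).
Context (N : set (aGL L F)) (subN : is_subgroup N) (closedN : closed N).
Implicit Types (S T : {fset L}) (g h : aGL L F) (a b : aM L F).
Local Notation G S := (GL (preorder_plus S) F).
Local Notation M S := (incidence_ring (preorder_plus S) F).
Hypothesis transvN : forall s t e, s != t -> mx_mem N (1 + elem s t e).

Lemma GL_mx S (g : aGL L F) : M S (val (mx g)) -> M S (val (mx g^-1%g)) -> G S (aGL_val g).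
Proof.
move=> gS gS'; split=> //; exists (val (mx g^-1%g)) => //.
rewrite (plus_mulE gS gS') (plus_mulE gS' gS).
by split; [exact: (congr1 val (mxVr g))|exact: (congr1 val (mxV g))].
Qed.

Lemma mx_GL S g : G S (aGL_val g) -> M S (val (mx g)) /\ M S (val (mx g^-1%g)).
Proof.
move=> [gS [b bS [gb _]]]; split=> //.
have bM : @aM_set _ L F b by exists S.
suff -> : mx g^-1%g = aM_of bM by [].
rewrite -[RHS]mul1r -(mxV g) -mulrA (_ : _ * aM_of bM = 1) ?mulr1//.
by apply: val_inj; rewrite /= -(plus_mulE gS bS).
Qed.

Lemma incidence_diag S (a : aM L F) : (forall s t : L, s != t -> coef a s t = 0) -> M S (val a).
Proof.
by move=> da s t; apply: contraNT => st; apply/eqP/da; apply: contraNneq st => ->.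
Qed.

(** Diagonal matrices lie in [M S] for every [S], so dilations at varying positions stay in a fixed
    GL of [L + S]. *)
Lemma dilation_lift S (s : L) (e : F) : e != 0 ->
  exists2 g : aGL L F, mx g = 1 + elem s s (e - 1) & G S (aGL_val g).
Proof.
move=> e0.
have diag (c : F) (x y : L) : x != y -> coef (1 + elem s s c) x y = 0.
  move=> xy; rewrite coefD coef1 coef_elem (negPf xy) add0r.
  have [<-|] := eqVneq x s; last by rewrite !mul0r.
  by rewrite [y == x]eq_sym (negPf xy) mulr0.
have d1 := dilation_inv s e0; have d2 := dilation_inv s (invr_neq0 e0).
rewrite invrK in d2.
have [g [ga ga']] := mx_lift d1 d2; exists g => //.
by apply: (@GL_mx S g); rewrite ?ga ?ga'; apply: incidence_diag => x y; exact: diag.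
Qed.

(** The classical factorization of diag(e, e^-1) into four elementary matrices of size two, placed
    at [s] and [u]. *)
Lemma mx_mem_dilation_pair (s u : L) (e : F) : s != u -> e != 0 ->
  mx_mem N ((1 + elem s s (e - 1)) * (1 + elem u u (e^-1 - 1))).
Proof.
move=> su e0; have us : u != s by rewrite eq_sym.
suff -> : (1 + elem s s (e - 1)) * (1 + elem u u (e^-1 - 1)) =
    (1 + elem u s (- e^-1)) * ((1 + elem s u (e - 1)) *
    ((1 + elem u s 1) * (1 + elem s u (- ((e - 1) / e))))) :> aM L F.
  by do ![apply: mx_memM => //]; apply: transvN.
apply: coef_inj => x y; rewrite !coef_transvM !coefD !coef1 !coef_elem !eqxx.
rewrite ![y == _]eq_sym (negPf su) (negPf us).
by have [->|_] := eqVneq x s; [|have [->|_] := eqVneq x u];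
  rewrite ?(negPf su) ?(negPf us) /=; field.
Qed.

(* diag(e) at s is the limit of diag(e, e^-1) at (s, u) as u leaves every finite
   set; all of these lie in GL_L. *)
Lemma mx_mem_dilation s (e : F) : e != 0 -> mx_mem N (1 + elem s s (e - 1)).
Proof.
move=> e0; have [g ga gS] := dilation_lift fset0 s e0; exists g => //.
apply: (closed_approx closedN gS) => T.
have [u _] := infinite_notin (s :: enum_fset T) L_infinite (finite_set0 L).
rewrite inE negb_or => /andP[us uT].
have [h ha hS] := dilation_lift fset0 u (invr_neq0 e0).
have [k Nk ka] := mx_mem_dilation_pair (negbT (etrans (eq_sym s u) (negPf us))) e0.
have ek : k = (g * h)%g by apply: mx_inj; rewrite mxM ga ha.
exists k; split=> //.
  by rewrite ek aGL_valM (aGL_mulE gS hS); exact: GL_mul.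
move=> x y xT yT; rewrite -!coef_mx ka ga coef_transvM.
have yu : y == u = false by apply: contraNF uT => /eqP <-.
by rewrite !coefD !coef1 !coef_elem yu !mulr0 !addr0 [y == s]eq_sym mulrA.
Qed.

Lemma trunc_subproof T (a : aM L F) : aM_set (fun p : L * L =>
  if (p.1 \in T) && (p.2 \in T) then val a p else (p.1 == p.2)%:R).
Proof.
have [S aS] := aM_valP a; exists S => s t /=; case: ifP => _; first exact: aS.
exact: (@incidence_one_in _ (preorder_plus S)).
Qed.

(** Filling with the identity rather than zero keeps the truncation finitary and lets it be
    invertible. *)
Definition trunc T a : aM L F := aM_of (trunc_subproof T a).

Lemma coef_trunc T a s t : coef (trunc T a) s t =
  if (s \in T) && (t \in T) then coef a s t else (s == t)%:R.
Proof. by []. Qed.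

Lemma incidence_trunc S T a : M S (val a) -> M S (val (trunc T a)).
Proof.
move=> aS s t /=; case: ifP => _; first exact: aS.
exact: (@incidence_one_in _ (preorder_plus S)).
Qed.

(** By the convexity hypothesis each term contributing to an entry of the block has its middle index
    in [T], so truncation loses no term. *)
Lemma truncM T a b : a * b = 1 ->
  (forall s t r, s \in T -> t \in T -> coef a s r * coef b r t != 0 -> r \in T) ->
  trunc T a * trunc T b = 1.
Proof.
move=> ab convT; apply: coef_inj => s t.
have [sT|sT] := boolP (s \in T); last first.
  rewrite (@coefM_single _ _ _ _ _ s t s).
    by rewrite !coef_trunc (negPf sT) /= eqxx mul1r.
  by move=> r rs; rewrite coef_trunc (negPf sT) /= eq_sym (negPf rs) mul0r.
have [tT|tT] := boolP (t \in T); last first.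
  rewrite (@coefM_single _ _ _ _ _ s t t).
    by rewrite !coef_trunc (negPf tT) !andbF /= eqxx mulr1.
  by move=> r rt; rewrite !coef_trunc (negPf tT) andbF (negPf rt) mulr0.
rewrite -ab !coefM; apply: eq_fsbigr => r _.
rewrite !coef_trunc sT tT /= andbT; case: ifPn => // rT.
rewrite (_ : s == r = false) ?mul0r; last by apply: contraNF rT => /eqP <-.
by apply/esym/eqP; apply: contraNT rT; exact: convT.
Qed.

(* Truncation to a finite order-convex set of indices is multiplicative, so that
   g is approximated by invertible finitary matrices of the same GL_(L + S). *)
Lemma closed_transvections_all g : N g.
Proof.
have [S _ gS] := aGL_valP g; apply: (closed_approx closedN gS) => T.
(* [A] is the convex hull of [T] in [L + S]: finite by local finiteness, and convex by
   transitivity. *)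
pose I s t := [set r : L | (s <= r :> preorder_plus S)%O && (r <= t :> preorder_plus S)%O].
pose A : set L := \bigcup_(s in [set` T]) \bigcup_(t in [set` T]) I s t.
have finA : finite_set A.
  apply: bigcup_finite => // s _; apply: bigcup_finite => // t _.
  exact: (@finite_itv _ (preorder_plus S)).
have memA r : (r \in fset_set A) = (r \in A) by rewrite in_fset_set.
have [aS bS] := mx_GL gS; pose a := mx g; pose b := mx g^-1%g.
have conv (x y : aM L F) : M S (val x) -> M S (val y) -> forall s t r,
    s \in fset_set A -> t \in fset_set A -> coef x s r * coef y r t != 0 ->
    r \in fset_set A.
  move=> xS yS s t r; rewrite !memA => /set_mem[s1 s1T [s2 s2T /andP[s1s ss2]]].
  move=> /set_mem[t1 t1T [t2 t2T /andP[t1t tt2]]]; rewrite mulf_eq0 negb_or.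
  move=> /andP[/xS sr /yS rt]; apply/mem_set.
  exists s1 => //; exists t2 => //; apply/andP; split.
    exact: le_trans s1s sr.
  exact: le_trans rt tt2.
have ab := truncM (mxVr g) (conv _ _ aS bS).
have ba := truncM (mxV g) (conv _ _ bS aS).
have [h ha] : mx_mem N (trunc (fset_set A) a).
  apply: (mx_mem_finitary subN transvN mx_mem_dilation (fset_uniq (fset_set A)) ab ba).
  by move=> s t /negPf st; rewrite coef_trunc st.
move=> hT; exists h; split=> //.
  apply: GL_mx; first by rewrite hT; exact: incidence_trunc.
  have -> : mx h^-1%g = trunc (fset_set A) b.
    by rewrite -[LHS]mulr1 -ab mulrA -hT mxV mul1r.
  exact: incidence_trunc.
have TA x : x \in T -> x \in fset_set A.
  by move=> xT; rewrite memA; apply/mem_set; do 2 exists x => //; apply/andP; split; exact: lexx.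
by move=> s t /TA sA /TA tA; rewrite -!coef_mx hT coef_trunc sA tA.
Qed.

End Density.

(** * The center and the simplicity of the quotient *)

Section Center.
Import GRing.Theory.
Local Open Scope ring_scope.
Context {d : Order.disp_t} {L : lfPreorderType d} {F : topologicalFieldType}.
Context (L_infinite : infinite_set [set: L]).

(** Commuting with a transvection amounts to commuting with its matrix unit. *)
Lemma group_centerP (z : aGL L F) :
  group_center (aGL L F) z <-> is_scalar (mx z).
Proof.
split=> [zC|[dz sz] x].
  apply: (is_scalarP L_infinite) => i j ij.
  have [x [xE _]] := elem_lift (1 : F) ij.
  have := congr1 mx (zC x); rewrite !mxM xE mulrDr mulrDl mulr1 mul1r.
  exact: addrI.
apply: mx_inj; rewrite !mxM; apply: coef_inj => s t.
rewrite (@coefM_single _ _ _ _ _ s t s) => [|r rs].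
  rewrite (@coefM_single _ _ _ _ _ s t t) => [|r rt]; first by rewrite mulrC (sz s t).
  by rewrite dz ?mulr0.
by rewrite dz ?mul0r// eq_sym.
Qed.

Lemma center_neq_full : group_center (aGL L F) <> [set: aGL L F].
Proof.
have [i _ _] := infinite_notin [::] L_infinite (finite_set0 L).
have [j _] := infinite_notin [:: i] L_infinite (finite_set0 L).
rewrite inE => ji; have [x [xE _]] := elem_lift (1 : F) ji.
move=> CT; have /group_centerP[dx _] : group_center (aGL L F) x by rewrite CT.
have := dx j i ji; rewrite xE coefD coef1 coef_elem (negPf ji) !eqxx !mulr1 add0r.
by move=> /eqP; rewrite oner_eq0.
Qed.

(** Being scalar is a family of equations between entries; entries are continuous on each GL of
    [L + S], and points of [F] are closed since [F] is Hausdorff. *)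
Lemma closed_center : closed (group_center (aGL L F)).
Proof.
apply/closed_aGLE => S.
pose f (p : L * L) : GL_top (preorder_plus S) F -> F :=
  fun x => (set_val x : {ptws L * L -> F}) p.
have cf p : continuous (f p).
  move=> x; apply: (@continuous_comp (GL_top (preorder_plus S) F) {ptws L * L -> F} F
    set_val (@proj _ (fun=> F) p)); first exact: initial_continuous.
  exact: proj_continuous.
have F0 : closed [set (0 : F)].
  by apply: accessible_closed_set1; apply: hausdorff_accessible; exact: field_hausdorff.
have cfB p q : closed [set x | f p x - f q x = 0].
  apply: (@preimage_closed _ _ (fun x => f p x - f q x) [set 0]) => // x _.
  apply: (@continuous_comp _ _ _ (fun x => (f p x, f q x)) (fun z : F * F => z.1 - z.2)).
    by apply: cvg_pair; [exact: nbhs_filter|exact: (cf p x)|exact: (cf q x)].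
  exact: sub_continuous.
rewrite (_ : _ @^-1` _ =
  \bigcap_(p in [set p : L * L | p.1 != p.2]) [set x | f p x = 0] `&`
  \bigcap_(p in [set: L * L]) [set x | f (p.1, p.1) x - f (p.2, p.2) x = 0]).
  apply: closedI; apply: closed_bigI => p _; last exact: cfB.
  exact: (@preimage_closed _ _ (f p) [set 0]).
apply/seteqP; split=> x.
  move=> /group_centerP[dx sx]; split=> -[s t] /= st; first exact: dx.
  by apply/eqP; rewrite subr_eq0; apply/eqP; exact: sx.
move=> [dx sx]; apply/group_centerP; split=> s t; first exact: (dx (s, t)).
by apply/eqP; rewrite -subr_eq0; apply/eqP; exact: (sx (s, t)).
Qed.

Lemma normal_sub_center (N : set (aGL L F)) : is_normal N -> closed N ->
  N <> [set: aGL L F] -> N `<=` group_center (aGL L F).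
Proof.
move=> normN closedN NT g Ng; apply: contrapT => gC; apply: NT.
have ngs : ~ is_scalar (mx g) by move=> /group_centerP.
have [i [j [c [ij c0 mem]]]] := transvection_of_nonscalar L_infinite normN Ng ngs.
have transvN := transvection_all L_infinite normN ij c0 mem.
apply/seteqP; split=> // h _; have [subN _] := normN.
exact: (closed_transvections_all L_infinite subN closedN transvN).
Qed.

(** The preimage of [N] under the projection is closed and normal, so it is the whole group or lies
    in the center, whose image is trivial. *)
Lemma aPGL_simple : topologically_simple (aPGL L F).
Proof.
move=> N [[N1 NM NV] NJ] closedN.
pose C := center_normal (aGL L F).
pose p (x : aGL L F) : aPGL L F := \pi_(quotg C)%qT x.
have pM x y : p (x * y)%g = (p x * p y)%g by rewrite /p quotg_mulE.
have p1 : p 1%g = 1%g by [].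
have pV x : p x^-1%g = (p x)^-1%g.
  by rewrite -[RHS]mulg1 -p1 -(mulgV x) pM mulKg.
have psurj (y : aPGL L F) : exists x, p x = y.
  by exists (repr y); exact: reprK.
have normA : is_normal (p @^-1` N).
  split; first split=> [|x y Nx Ny|x Nx]; rewrite /preimage/=.
  - by rewrite p1.
  - by rewrite pM; exact: NM.
  - by rewrite pV; exact: NV.
  - move=> x g Nx; rewrite /preimage/= conjgE !pM pV -conjgE; exact: NJ.
have closedA : closed (p @^-1` N).
  by rewrite -openC preimage_setC; apply: (proj1 (quotg_open (~` N))); rewrite openC.
have [AT|AT] := pselect (p @^-1` N = setT).
  right; apply/seteqP; split=> // y _; have [x <-] := psurj y.
  by have : (p @^-1` N) x by rewrite AT.
left; apply/seteqP; split=> [y Ny|y ->//].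
have [x xy] := psurj y; rewrite -xy in Ny *.
have xC := normal_sub_center normA closedA AT Ny.
apply/quotg_eqP; rewrite mulg1.
by have [[_ _ CV] _] := group_center_normal (aGL L F); exact: CV.
Qed.

End Center.

Theorem theorem3p19 (F : topologicalFieldType) (d : Order.disp_t)
    (L : lfPreorderType d) (L_infinite : infinite_set [set: L]) :
  [/\ is_normal (group_center (aGL L F)),
      closed (group_center (aGL L F)),
      group_center (aGL L F) <> [set: aGL L F],
      (forall N : set (aGL L F), is_normal N -> closed N -> N <> [set: aGL L F] ->
         N `<=` group_center (aGL L F)) &
      topologically_simple (aPGL L F)].
Proof.
split.
- exact: group_center_normal.
- exact: closed_center.
- exact: center_neq_full.
- by move=> N; exact: normal_sub_center.
- exact: aPGL_simple.
Qed.
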